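(* Let $\{D_I\}_{I\in\binom{[n]}{2}}$ be a family of positive real numbers satisfying the triangle inequalities. There exists a pruned positive-weighted polygon $\mathcal P=(P,w)$ with $V(P)=[n]$ such that $D_{i,j}(\mathcal P)=D_{i,j}$ for all distinct $i,j\in[n]$ if and only if: (i) for every $i\in[n]$ there are exactly two elements $x,y\in[n]\setminus\{i\}$ such that $D_{i,x}$ and $D_{i,y}$ are indecomposable; (ii) the set $H$ produced by the renaming procedure below has cardinality $n$; (iii) after renaming the elements of $[n]$ by that procedure, for all $a<b$ in $[n]$, $$D_{a,b}=\min\Big\{\sum_{i=a}^{b-1}D_{i,i+1},\ \sum_{i=b}^{n-1}D_{i,i+1}+D_{1,n}+\sum_{i=1}^{a-1}D_{i,i+1}\Big\}.$$ Renaming procedure (defined when (i) holds): rename as $1$ and $2$ two elements with $D_{1,2}=\min D_{i,j}$, and set $H=\{1,2\}$; rename as $3$ the unique element of $[n]\setminus\{1,2\}$ such that $D_{2,3}$ is indecomposable and add $3$ to $H$; recursively, rename as $i+1$ the unique element of $[n]\setminus\{i-1,i\}$ such that $D_{i,i+1}$ is indecomposable; if it already belongs to $H$ stop, otherwise add it to $H$ and continue.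
   Context: Write $D_{i,j}=D_{\{i,j\}}$. The triangle inequalities: $D_{i,j}\le D_{i,k}+D_{k,j}$ for distinct $i,j,k$. $D_{i,j}$ is indecomposable if $D_{i,j}<D_{i,z}+D_{z,j}$ for all $z\in[n]\setminus\{i,j\}$. A polygon with $n$ vertices is a graph whose vertices can be named $i_1,\dots,i_n$ with edge set $\{e(i_1,i_2),\dots,e(i_{n-1},i_n),e(i_n,i_1)\}$. A positive-weighted graph $\mathcal G=(G,w)$ has $w:E(G)\to\mathbb R_{>0}$, and $D_{i,j}(\mathcal G)$ is the minimum total weight of a path from $i$ to $j$ (such a minimum-weight path realizes it). An edge $e$ is useful if there exist vertices $a,b$ such that every path realizing $D_{a,b}(\mathcal G)$ contains $e$; $\mathcal G$ is pruned if all its edges are useful. *)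

(* Defs.v *)
From HB Require Import structures.
From mathcomp Require Import all_boot all_order all_algebra.
From mathcomp Require Import reals.

Set Implicit Arguments.
Unset Strict Implicit.
Unset Printing Implicit Defensive.

Import Order.TTheory GRing.Theory Num.Theory.
Local Open Scope ring_scope.

Record wgraph (R : realType) (T : finType) := WGraph {
  edges : {set {set T}};
  weight : {set T} -> R;
  edges_card : forall e, e \in edges -> #|e| = 2%N;
  weight_gt0 : forall e, e \in edges -> 0 < weight e
}.

Definition adj (R : realType) (T : finType) (G : wgraph R T) : rel T :=
  fun x y => [set x; y] \in edges G.

(* As in path.v, the path visiting a, p_0, p_1, ... is given by the pair of
   its first vertex a and the sequence p. *)
Definition is_path (R : realType) (T : finType) (G : wgraph R T)
    (a b : T) (p : seq T) : bool :=
  [&& path (adj G) a p, last a p == b & uniq (a :: p)].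

Definition path_edges (T : finType) (a : T) (p : seq T) : seq {set T} :=
  pairmap (fun x y => [set x; y]) a p.

Definition path_weight (R : realType) (T : finType) (G : wgraph R T)
    (a : T) (p : seq T) : R :=
  \sum_(e <- path_edges a p) weight G e.

(* D_{a,b}(G) is defined and equal to d. *)
Definition is_dist (R : realType) (T : finType) (G : wgraph R T)
    (a b : T) (d : R) : Prop :=
  (exists2 p, is_path G a b p & path_weight G a p = d) /\
  (forall p, is_path G a b p -> d <= path_weight G a p).

Definition realizes (R : realType) (T : finType) (G : wgraph R T)
    (a b : T) (p : seq T) : Prop :=
  is_path G a b p /\ is_dist G a b (path_weight G a p).

(* The is_dist clause only matters for disconnected graphs: it discards the
   pairs a, b that no path joins, for which the last clause is vacuous. *)
Definition useful (R : realType) (T : finType) (G : wgraph R T)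
    (e : {set T}) : Prop :=
  exists a b : T, (exists d, is_dist G a b d) /\
    forall p, realizes G a b p -> e \in path_edges a p.

Definition pruned (R : realType) (T : finType) (G : wgraph R T) : Prop :=
  forall e, e \in edges G -> useful G e.

(* ordS is the cyclic successor of 'I_n, so the last edge is {v_(n-1), v_0}. *)
Definition polygon (R : realType) (T : finType) (n : nat) (G : wgraph R T)
    : Prop :=
  (3 <= n)%N /\
  exists2 v : 'I_n -> T, bijective v &
    edges G = [set [set v k; v (ordS k)] | k : 'I_n].

(* Only the values of D on sets of cardinality 2 are ever relevant. *)
Definition entry (R : realType) (T : finType) (D : {set T} -> R)
    (i j : T) : R :=
  D [set i; j].

Definition indecomposable (R : realType) (T : finType) (D : {set T} -> R)
    (i j : T) : bool :=
  [forall z, (z != i) && (z != j) ==> (entry D i j < entry D i z + entry D z j)].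

(* H lists the elements named so far, in order of naming; u and v are the last
   two. When every vertex has exactly two indecomposable partners and u is one
   of those of v, the element picked is the unique one. *)
Fixpoint rename_from (R : realType) (T : finType) (D : {set T} -> R)
    (fuel : nat) (u v : T) (H : seq T) : seq T :=
  if fuel is fuel'.+1 then
    if [pick z | (z != u) && (z != v) && indecomposable D v z] is Some z then
      if z \in H then H else rename_from D fuel' v z (rcons H z)
    else H
  else H.

(* Each iteration that does not stop adds a new element to H, so that #|T|
   iterations always reach the stopping test. *)
Definition rename (R : realType) (T : finType) (D : {set T} -> R) (x1 x2 : T)
    : seq T :=
  rename_from D #|T| x1 x2 [:: x1; x2].

(* The element renamed as k, names starting from 1. *)
Definition named (R : realType) (T : finType) (D : {set T} -> R) (x1 x2 : T)
    (k : nat) : T :=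
  nth x1 (rename D x1 x2) k.-1.

(* Main.v *)
(** In a finite family with the triangle inequalities, a decomposable D_{a,b}
    splits as D_{a,z} + D_{z,b} with both terms strictly smaller, so the graph of
    the indecomposable pairs, weighted by D, is connected and realizes D; it is
    pruned because an indecomposable pair is joined by no other shortest path.
    Conversely a pruned graph realizing D has exactly the indecomposable pairs as
    edges: a decomposable edge could be bypassed in every path using it.  Hence a
    pruned polygon realizing D exists iff the graph of indecomposable pairs is a
    polygon.  Being connected, it is one as soon as it is 2-regular, which is
    (i); the renaming procedure then walks around the polygon, and (iii) says
    that distances in a polygon are lengths of shortest arcs. *)

Require Import Defs.
From HB Require Import structures.
From mathcomp Require Import all_boot all_order all_algebra.
From mathcomp Require Import reals.
From mathcomp Require Import zify lra.

Set Implicit Arguments.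
Unset Strict Implicit.
Unset Printing Implicit Defensive.

Import Order.TTheory GRing.Theory Num.Theory.
Local Open Scope ring_scope.

(** * Shortening walks to paths *)

Section Walks.
Variables (R : realType) (T : finType) (G : wgraph R T).

Lemma path_edges_cat (a : T) (p q : seq T) :
  path_edges a (p ++ q) = path_edges a p ++ path_edges (last a p) q.
Proof. exact: pairmap_cat. Qed.

Lemma path_weight_cons (a z : T) (p : seq T) :
  path_weight G a (z :: p) = weight G [set a; z] + path_weight G z p.
Proof. by rewrite /path_weight big_cons. Qed.

Lemma path_weight_cat (a : T) (p q : seq T) :
  path_weight G a (p ++ q) = path_weight G a p + path_weight G (last a p) q.
Proof. by rewrite /path_weight path_edges_cat big_cat. Qed.

Lemma adj_neq (a b : T) : adj G a b -> a != b.
Proof. by move/edges_card; rewrite cards2; case: eqP. Qed.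

Lemma path_weight_ge0 (a : T) (p : seq T) :
  path (adj G) a p -> 0 <= path_weight G a p.
Proof.
elim: p a => [|z p IH] a /=; first by rewrite /path_weight big_nil.
case/andP=> /weight_gt0 /ltW w_ge0 /IH p_ge0.
by rewrite path_weight_cons addr_ge0.
Qed.

Lemma weight_path_edges_le (a : T) (p : seq T) (e : {set T}) :
  path (adj G) a p -> e \in path_edges a p -> weight G e <= path_weight G a p.
Proof.
elim: p a => [|z p IH] a //= /andP[az zp]; rewrite inE path_weight_cons.
case/orP=> [/eqP->|/(IH _ zp) le_e]; first by rewrite lerDl path_weight_ge0.
by rewrite (le_trans le_e) // lerDr ltW // weight_gt0.
Qed.

(** If [a] recurs later, the loop back to [a] is cut out; positive weights make this no heavier. The
    inclusion of edges ensures that a walk avoiding an edge yields a path avoiding it. *)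
Lemma walk_to_path (a : T) (p : seq T) :
  path (adj G) a p ->
  exists q, [/\ is_path G a (last a p) q,
    path_weight G a q <= path_weight G a p &
    {subset path_edges a q <= path_edges a p}].
Proof.
elim: p a => [|z p IH] a /=.
  by move=> _; exists [::]; split; rewrite /is_path /= ?eqxx.
case/andP=> az /IH[q [/and3P[zq q_last q_uniq] le_q sub_q]].
have w_ge0 : 0 <= weight G [set a; z] by rewrite ltW // weight_gt0.
case: (boolP (a \in z :: q)) => [|a_notin]; last first.
  exists (z :: q); split; first by rewrite /is_path /= az zq q_last a_notin.
    by rewrite !path_weight_cons lerD2l.
  by move=> e /=; rewrite !inE => /orP[->//|/sub_q->]; rewrite orbT.
rewrite inE (negPf (adj_neq az)) /= => a_q.
case/splitPr: a_q zq q_last q_uniq le_q sub_q => q1 q2.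
rewrite cat_path /= last_cat /= cat_uniq /= path_weight_cat path_weight_cons.
rewrite path_edges_cat /=.
move=> /and3P[zq1 q1a aq2] q2_last /andP[_ /and3P[_ _ q2_uniq]] le_q sub_q.
exists q2; split; first by rewrite /is_path aq2 q2_last.
  rewrite path_weight_cons (le_trans _ (ler_wpDl w_ge0 le_q)) // addrA lerDr.
  by rewrite addr_ge0 ?path_weight_ge0 // ltW // weight_gt0.
by move=> e e_q2; rewrite inE sub_q ?orbT // mem_cat inE e_q2 !orbT.
Qed.

End Walks.

(** * The weighted graph of indecomposable pairs *)

Section Indecomposable.
Variables (R : realType) (T : finType) (D : {set T} -> R).
Hypothesis D_gt0 : forall I : {set T}, #|I| = 2%N -> 0 < D I.

(** On the diagonal, [indecomposable] would depend on the arbitrary value of [D] on a singleton,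
    hence the guard. *)
Definition link : rel T := fun a b => (b != a) && indecomposable D a b.

Lemma entryC (a b : T) : entry D a b = entry D b a.
Proof. by rewrite /entry setUC. Qed.

Lemma entry_gt0 (a b : T) : a != b -> 0 < entry D a b.
Proof. by move=> ab; rewrite D_gt0 // cards2 ab. Qed.

Lemma link_sym (a b : T) : link a b = link b a.
Proof.
rewrite /link eq_sym; congr (_ && _); apply: eq_forallb => z.
rewrite (entryC a b) (entryC a z) (entryC z b) addrC.
by case: (z != a); case: (z != b).
Qed.

Lemma linkP (a b : T) :
  reflect (b != a /\
    forall z, z != a -> z != b -> entry D a b < entry D a z + entry D z b)
    (link a b).
Proof.
apply: (iffP andP) => -[ba H]; split=> //.
  by move=> z za zb; move/forallP/(_ z): H; rewrite za zb.
by apply/forallP => z; apply/implyP => /andP[]; apply: H.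
Qed.

Definition link_edges : {set {set T}} :=
  [set [set p.1; p.2] | p : T * T & link p.1 p.2].

Lemma link_edges_card (e : {set T}) : e \in link_edges -> #|e| = 2%N.
Proof.
case/imsetP=> -[a b]; rewrite inE /= => /andP[ba _] ->.
by rewrite cards2 eq_sym ba.
Qed.

Lemma link_edges_gt0 (e : {set T}) : e \in link_edges -> 0 < D e.
Proof. by move/link_edges_card/D_gt0. Qed.

Definition link_graph : wgraph R T := WGraph link_edges_card link_edges_gt0.

Lemma set2_inj (a b c d : T) :
  [set a; b] = [set c; d] -> (a = c /\ b = d) \/ (a = d /\ b = c).
Proof.
move=> /setP eq_set; have := eq_set a; have := eq_set b.
have := eq_set c; have := eq_set d; rewrite !inE !eqxx /= ?orbT.
do 2![move/orP=> [] /eqP ?]; do 2![move/esym/orP=> [] /eqP ?]; subst; auto.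
Qed.

Lemma adj_link_graph (a b : T) : adj link_graph a b = link a b.
Proof.
apply/imsetP/idP => [[[c d]] | ab]; last by exists (a, b); rewrite ?inE.
rewrite inE /= => cd /set2_inj[][-> ->] //.
by rewrite link_sym.
Qed.

Lemma path_weight_link_cons (a z : T) (p : seq T) :
  path_weight link_graph a (z :: p)
  = entry D a z + path_weight link_graph z p.
Proof. exact: path_weight_cons. Qed.

Hypothesis D_triangle : forall i j k : T, i != j -> i != k -> j != k ->
  entry D i j <= entry D i k + entry D k j.

Lemma entry_le_path_weight (a b : T) (p : seq T) :
  a != b -> path (adj link_graph) a p -> last a p = b ->
  entry D a b <= path_weight link_graph a p.
Proof.
elim: p a => [|z p IH] a ab /=; first by move=> _ eq_ab; rewrite eq_ab eqxx in ab.
case/andP=> az zp p_last; rewrite path_weight_link_cons.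
case: (eqVneq z b) => [<-|zb]; first by rewrite lerDl path_weight_ge0.
rewrite (le_trans (D_triangle ab (adj_neq az) _)) ?(eq_sym b) //.
by rewrite lerD2l IH.
Qed.

(* A decomposable pair splits into two pairs with strictly smaller values. *)
Lemma link_walk (a b : T) : a != b ->
  exists p, [/\ path (adj link_graph) a p, last a p = b &
    path_weight link_graph a p = entry D a b].
Proof.
(* Induction measure replacing the size of the real [entry D x y]. It drops strictly because a pair
   of smaller value belongs to [smaller a b] but not to its own set. *)
pose smaller (x y : T) : {set T * T} :=
  [set u | (u.1 != u.2) && (entry D u.1 u.2 < entry D x y)].
have [m] := ubnP #|smaller a b|; elim: m => // m IH in a b *.
rewrite ltnS => le_m ab.
case: (boolP (link a b)) => [ab_link|].
  exists [:: b]; split=> //=; first by rewrite adj_link_graph ab_link.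
  by rewrite path_weight_link_cons /path_weight big_nil addr0.
rewrite /link eq_sym ab /= negb_forall => /existsP[z].
rewrite negb_imply -leNgt => /andP[/andP[za zb] le_z].
have az : a != z by rewrite eq_sym.
have lt_smaller x y : x != y -> entry D x y < entry D a b ->
    (#|smaller x y| < m)%N.
  move=> xy lt_xy; apply: leq_trans le_m; apply: proper_card.
  apply/properP; split.
    by apply/subsetP => u; rewrite !inE => /andP[-> /lt_trans->].
  by exists (x, y); rewrite !inE /= xy ?ltxx.
have := entry_gt0 az; have := entry_gt0 zb => zb_gt0 az_gt0.
have [|p [az_p p_last p_w]] := IH a z _ az; first by rewrite lt_smaller //; lra.
have [|q [zb_q q_last q_w]] := IH z b _ zb; first by rewrite lt_smaller //; lra.
exists (p ++ q); rewrite cat_path last_cat path_weight_cat p_last az_p zb_q.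
split=> //; rewrite p_w q_w; apply/le_anti; rewrite le_z /=.
by apply: D_triangle; rewrite ?(eq_sym b).
Qed.

Lemma link_graph_dist (a b : T) :
  a != b -> is_dist link_graph a b (entry D a b).
Proof.
move=> ab; split; last first.
  by move=> p /and3P[ap /eqP p_last _]; apply: entry_le_path_weight.
have [p [ap p_last p_w]] := link_walk ab.
have [q [q_path le_q _]] := walk_to_path ap.
exists q; first by rewrite -p_last.
apply/le_anti; rewrite -{1}p_w le_q /=.
by case/and3P: q_path => aq /eqP q_last _; rewrite entry_le_path_weight // q_last.
Qed.

(** An edge is useful for its own endpoints: a path leaving [a] through [z != b] weighs at least
    [entry D a z + entry D z b], which exceeds [entry D a b]. *)
Lemma link_graph_pruned : pruned link_graph.
Proof.
move=> e /imsetP[[a b]]; rewrite inE /= => ab_link ->.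
have /linkP[ba indec] := ab_link; have ab : a != b by rewrite eq_sym.
have [[p0 p0_path p0_w] _] := link_graph_dist ab.
exists a, b; split; first by exists (entry D a b); apply: link_graph_dist.
move=> [|z p] [/and3P[] /= + p_last].
  by rewrite (eqP p_last) eqxx in ba.
case/andP=> az zp _ [_ min_p].
have [<-|zb] := eqVneq z b; first by rewrite inE eqxx.
have := min_p _ p0_path; rewrite p0_w path_weight_link_cons leNgt => /negP[].
apply: lt_le_trans (indec z _ zb) _; first by rewrite eq_sym (adj_neq az).
by rewrite lerD2l entry_le_path_weight //; apply/eqP.
Qed.

End Indecomposable.

(** * Edges of a pruned realization are the indecomposable pairs *)

Section PrunedEdges.
Variables (R : realType) (T : finType) (D : {set T} -> R) (G : wgraph R T).
Hypothesis G_dist : forall i j : T, i != j -> is_dist G i j (entry D i j).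
Hypothesis G_pruned : pruned G.

Lemma entry_le_weight (a b : T) : adj G a b -> entry D a b <= weight G [set a; b].
Proof.
move=> ab; have [_ /(_ [:: b])] := G_dist (adj_neq ab).
rewrite /is_path path_weight_cons /path_weight big_nil addr0 /= ab eqxx inE.
by rewrite (adj_neq ab) => /(_ isT).
Qed.

(** A shortest path lighter than [m] cannot contain an edge of weight [m]; here [m] will be the
    weight of the edge to bypass. *)
Lemma light_walk (a b : T) (m : R) : a != b -> entry D a b < m ->
  exists p, [/\ path (adj G) a p, last a p = b, path_weight G a p = entry D a b &
    forall e, weight G e = m -> e \notin path_edges a p].
Proof.
move=> ab lt_m; have [[p /and3P[ap /eqP p_last _] p_w] _] := G_dist ab.
exists p; split=> // e e_m; apply/negP => /(weight_path_edges_le ap).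
by rewrite p_w e_m leNgt lt_m.
Qed.

(* A walk bypassing a decomposable edge, spliced into any walk that uses this
   edge, shows that the edge is useless. *)
Lemma pruned_adj_link (a b : T) :
  (forall I : {set T}, #|I| = 2%N -> 0 < D I) -> adj G a b -> link D a b.
Proof.
move=> D_gt0 ab; have a_neq_b := adj_neq ab.
rewrite /link eq_sym a_neq_b /=; apply: contraT; rewrite negb_forall.
case/existsP=> z; rewrite negb_imply -leNgt => /andP[/andP[za zb] le_z].
set e := [set a; b].
(* Both orientations are covered, as a walk may cross [e] either way. The two legs through [z] are
   each strictly lighter than [e], so neither uses it. *)
have bypass x y : [set x; y] = e -> exists p, [/\ path (adj G) x p,
    last x p = y, path_weight G x p <= weight G e & e \notin path_edges x p].
  move=> xy_e.
  have [xz zy le_xy] : [/\ x != z, z != y &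
      entry D x z + entry D z y <= entry D x y].
    case: (set2_inj xy_e) => -[-> ->]; split=> //; rewrite 1?eq_sym //.
    by rewrite addrC (entryC D z a) (entryC D b z) (entryC D b a).
  have xy : adj G x y by rewrite /adj xy_e.
  have := entry_le_weight xy; rewrite xy_e => le_e.
  have := entry_gt0 D_gt0 xz; have := entry_gt0 D_gt0 zy => zy_gt0 xz_gt0.
  have [|p [xp p_last p_w p_e]] := @light_walk x z (weight G e) xz; first by lra.
  have [|q [zq q_last q_w q_e]] := @light_walk z y (weight G e) zy; first by lra.
  exists (p ++ q); rewrite cat_path last_cat path_weight_cat path_edges_cat.
  rewrite p_last xp zq mem_cat negb_or p_e // q_e //; split=> //; lra.
have avoid p x : path (adj G) x p -> exists q, [/\ path (adj G) x q,
    last x q = last x p, path_weight G x q <= path_weight G x p &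
    e \notin path_edges x q].
  elim: p x => [|y p IH] x /=; first by exists [::].
  case/andP=> xy /IH[q [yq q_last le_q q_e]]; rewrite path_weight_cons.
  case: (eqVneq [set x; y] e) => [xy_e|xy_e].
    have [r [xr r_last le_r r_e]] := bypass x y xy_e.
    exists (r ++ q); rewrite cat_path last_cat path_weight_cat path_edges_cat.
    by rewrite r_last xr yq mem_cat negb_or r_e xy_e lerD.
  exists (y :: q); rewrite /= xy yq inE negb_or eq_sym xy_e q_e.
  by rewrite path_weight_cons lerD2l.
(* Rerouting a shortest path around [e] and then removing loops gives another shortest path, which
   contradicts the usefulness of [e]. *)
have [c [d [[m [[p p_path p_w] min_m]] use]]] := G_pruned ab.
case/and3P: (p_path) => cp /eqP p_last _.
have [q [cq q_last le_q /negP[]]] := avoid p c cp.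
have [r [r_path le_r sub_r]] := walk_to_path cq.
rewrite q_last p_last in r_path; apply/sub_r/use; split=> //; split.
  by exists r.
by move=> s /min_m; apply: le_trans; rewrite -p_w (le_trans le_r).
Qed.

(** If a shortest path from [a] to [b] began with [z != b], its weight would be at least
    [entry D a z + entry D z b]. *)
Lemma link_adj (a b : T) : link D a b -> adj G a b.
Proof.
case/linkP=> ba indec; have ab : a != b by rewrite eq_sym.
have [[[|z p] /and3P[/= ap p_last]]] := G_dist ab.
  by rewrite (eqP p_last) eqxx in ba.
case/andP: ap => az zp /andP[_ zp_uniq] p_w _.
have [<-//|zb] := eqVneq z b.
have := indec z _ zb; rewrite eq_sym (adj_neq az) => /(_ isT).
rewrite -p_w ltNge path_weight_cons lerD ?entry_le_weight //.
have [_ ->//] := G_dist zb.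
by rewrite /is_path zp p_last.
Qed.

End PrunedEdges.

(** * Cycles in a 2-regular relation *)

Section Cycles.
Variables (T : finType) (e : rel T).
Hypothesis e_sym : symmetric e.
Hypothesis deg2 : forall x, #|[set y | e x y]| = 2%N.

Lemma deg2_nbr (x y z w : T) :
  y != z -> e x y -> e x z -> e x w = (w == y) || (w == z).
Proof.
move=> yz xy xz; rewrite -in_set2.
suff -> : [set y; z] = [set w | e x w] by rewrite inE.
apply/eqP; rewrite eqEcard deg2 cards2 yz andbT.
by apply/subsetP => u; rewrite !inE => /orP[]/eqP->.
Qed.

(** Applying [ordS] to both sides reduces this to [k + 2] differing from [k] modulo [n]. *)
Lemma ordS_neq_pred (n : nat) (k : 'I_n) : (3 <= n)%N -> ordS k != ord_pred k.
Proof.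
move=> n3; rewrite -(inj_eq (@ordS_inj n)) ord_predK -val_eqE /=.
have := ltn_ord k; rewrite leq_eqVlt => /orP[/eqP k_eq|k_lt].
  by rewrite k_eq modnn modn_small; lia.
rewrite (modn_small k_lt); move: k_lt; rewrite leq_eqVlt => /orP[/eqP k_eq|k_lt].
  by rewrite k_eq modnn; lia.
by rewrite modn_small //; lia.
Qed.

Lemma cycle_nbr (n : nat) (v : 'I_n -> T) : (3 <= n)%N -> injective v ->
  (forall k, e (v k) (v (ordS k))) ->
  forall k w, e (v k) w = (w == v (ordS k)) || (w == v (ord_pred k)).
Proof.
move=> n3 v_inj v_e k w; apply: deg2_nbr => //.
  by rewrite (inj_eq v_inj) ordS_neq_pred.
by rewrite e_sym -{2}(ord_predK k).
Qed.

(** By [cycle_nbr] no step of [e] leaves the cycle, so by connectedness it is everything. *)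
Lemma cycle_onto (n : nat) (v : 'I_n -> T) (k0 : 'I_n) :
  (3 <= n)%N -> injective v -> (forall k, e (v k) (v (ordS k))) ->
  (forall x y, x != y -> exists2 p, path e x p & last x p = y) ->
  forall x, exists k, x = v k.
Proof.
move=> n3 v_inj v_e conn x.
case: (eqVneq (v k0) x) => [<-|/conn[p]]; first by exists k0.
elim: p k0 => [|y p IH] k0 /=; first by move=> _ <-; exists k0.
rewrite (cycle_nbr n3) // => /andP[/orP[]/eqP-> yp last_p]; exact: IH yp last_p.
Qed.

Lemma cycle_nth (x0 : T) (s : seq T) (k : nat) : cycle e s ->
  (k < size s)%N -> e (nth x0 s k) (nth x0 s (k.+1 %% size s)).
Proof.
case: s => [|x p] //= /(pathP x0)/(_ k); rewrite size_rcons => + k_lt.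
rewrite -rcons_cons !nth_rcons /= k_lt => /(_ isT).
move: k_lt; rewrite ltnS leq_eqVlt => /orP[/eqP->|k_lt].
  by rewrite ltnn eqxx modnn.
by rewrite k_lt modn_small.
Qed.

End Cycles.

(** * The renaming procedure closes a cycle *)

Section Renaming.
Variables (R : realType) (T : finType) (D : {set T} -> R).
Hypothesis deg2 : forall x, #|[set y | link D x y]| = 2%N.

(** Loop invariant: [H] is a simple path whose last two vertices are [u] and [v]. The bound on
    [fuel] excludes exhaustion, since [H] would then have more than [#|T|] elements. *)
Lemma rename_fromP (x1 : T) (p : seq T) (fuel : nat) :
  (0 < size p)%N -> uniq (x1 :: p) -> path (link D) x1 p ->
  (#|T| < fuel + size (x1 :: p))%N ->
  exists q, [/\ rename_from D fuel (nth x1 (x1 :: p) (size p).-1) (last x1 p)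
                  (x1 :: p) = x1 :: q,
    (0 < size q)%N, uniq (x1 :: q), path (link D) x1 q &
    exists2 z, z \in x1 :: q &
      (z != nth x1 (x1 :: q) (size q).-1) && link D (last x1 q) z].
Proof.
elim: fuel p => [|fuel IH] p p_gt0 p_uniq p_path.
  by rewrite add0n -(card_uniqP p_uniq) ltnNge max_card.
move=> lt_fuel; simpl rename_from.
set u := nth _ _ _; set v := last _ _.
case: pickP => [z /andP[/andP[zu zv] vz] | no_z].
  case: ifP => [z_p|z_p].
    by exists p; split=> //; exists z; rewrite // zu /link zv.
  have [||||q [q_eq q_gt0 q_uniq q_path q_z]] := IH (rcons p z).
  - by rewrite size_rcons.
  - by rewrite -rcons_cons rcons_uniq z_p.
  - by rewrite rcons_path p_path /link zv.
  - by move: lt_fuel; rewrite /= size_rcons !addnS.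
  exists q; split=> //; rewrite -q_eq last_rcons size_rcons /=.
  by rewrite -rcons_cons nth_rcons ltnSn -[size p]/(size (x1 :: p)).-1 nth_last.
(* The choice cannot fail: [v] has two partners, and at most one of them is [u]. *)
have := deg2 v; rewrite (cardsD1 u) => card2.
have /card_gt0P[z] : (0 < #|[set y | link D v y] :\ u|)%N.
  by move: card2; case: (_ \in _) => /= ; lia.
by rewrite !inE andbA no_z.
Qed.

Lemma rename_cycle (x1 x2 : T) : link D x1 x2 ->
  exists q, [/\ rename D x1 x2 = x1 :: q, (2 <= size q)%N, uniq (x1 :: q) &
    cycle (link D) (x1 :: q)].
Proof.
move=> x12; have /andP[x21 _] := x12.
have [||||q [q_eq q_gt0 q_uniq q_path [z z_q /andP[z_u z_link]]]] :=
  @rename_fromP x1 [:: x2] #|T|; rewrite ?addn2 //=.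
- by rewrite !inE eq_sym x21.
- by rewrite x12.
exists q; rewrite -q_eq; set h := nth x1 (x1 :: q).
have h_link k : (k < size q)%N -> link D (h k) (h k.+1).
  by move=> k_lt; apply: (pathP x1 q_path).
have h_last : last x1 q = h (size q) by rewrite (last_nth x1).
have h_inj i j : (i <= size q)%N -> (j <= size q)%N -> (h i == h j) = (i == j).
  by move=> i_le j_le; rewrite nth_uniq.
have [k k_le z_eq] : exists2 k, (k <= size q)%N & z = h k.
  by exists (index z (x1 :: q)); [rewrite -ltnS index_mem | rewrite /h nth_index].
rewrite z_eq h_last in z_link z_u.
have k_neq : k != size q.
  by apply: contraTneq z_link => ->; rewrite /link eqxx.
rewrite h_inj // in z_u; last by lia.
(* An inner vertex [h k] already has its two neighbours on the path; being linked to the last vertex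
   would make it the penultimate one, which is excluded. *)
have k0 : k = 0%N.
  case: k k_le k_neq z_u z_link {z_eq} => // k k_le k_neq z_u.
  rewrite link_sym (deg2_nbr deg2 (y := h k) (z := h k.+2)).
  - by rewrite !h_inj; lia.
  - by rewrite h_inj; lia.
  - by rewrite link_sym h_link; lia.
  - by rewrite h_link; lia.
(* With [size q = 1] the penultimate vertex would be [x1] itself, against [z_u]. *)
rewrite k0 in z_u z_link; split=> //; first by case: (size q) z_u q_gt0 => [|[]].
by rewrite /= rcons_path q_path h_last.
Qed.

End Renaming.

(** * Distances extended to the diagonal, and arc length on a circle *)

Section Arcs.
Variables (R : realType) (T : finType) (D : {set T} -> R).
Hypothesis D_gt0 : forall I : {set T}, #|I| = 2%N -> 0 < D I.
Hypothesis D_triangle : forall i j k : T, i != j -> i != k -> j != k ->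
  entry D i j <= entry D i k + entry D k j.

(* The value of D on a singleton is arbitrary, so the diagonal is set to 0. *)
Definition dist0 (a b : T) : R := if a == b then 0 else entry D a b.

Lemma dist0_ge0 (a b : T) : 0 <= dist0 a b.
Proof. by rewrite /dist0; case: eqVneq => // /(entry_gt0 D_gt0)/ltW. Qed.

Lemma dist0C (a b : T) : dist0 a b = dist0 b a.
Proof. by rewrite /dist0 eq_sym entryC. Qed.

Lemma dist0_triangle (a b c : T) : dist0 a b <= dist0 a c + dist0 c b.
Proof.
have [->|ac] := eqVneq a c; first by rewrite {2}/dist0 eqxx add0r.
have [->|cb] := eqVneq c b; first by rewrite {3}/dist0 eqxx addr0.
rewrite {1}/dist0; case: eqVneq => [_|ab]; first by rewrite addr_ge0 ?dist0_ge0.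
rewrite /dist0 (negPf ac) (negPf cb).
by apply: D_triangle => //; rewrite eq_sym.
Qed.

Lemma dist0_le_sum (g : nat -> T) (a b : nat) : (a <= b)%N ->
  dist0 (g a) (g b) <= \sum_(a <= i < b) dist0 (g i) (g i.+1).
Proof.
move=> /subnKC <-; elim: (b - a)%N => [|m IH].
  by rewrite addn0 big_geq // /dist0 eqxx.
rewrite addnS big_nat_recr /= ?leq_addr //.
by rewrite (le_trans (dist0_triangle _ _ (g (a + m)%N))) // lerD2r.
Qed.

(* On a circle of length S, the length of the shortest arc between two points
   at signed distance t. *)
Definition arc (S t : R) : R := Num.min `|t| (S - `|t|).

Lemma arc_lipschitz (S t u : R) : arc S t <= arc S u + `|t - u|.
Proof.
rewrite /arc; case: (ger0P t); case: (ger0P u); case: (ger0P (t - u));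
  rewrite !minEle; case: ifP; case: ifP => *; lra.
Qed.

Lemma arcN (S t : R) : arc S (- t) = arc S t.
Proof. by rewrite /arc normrN. Qed.

Lemma arc_compl (S t : R) : 0 <= t <= S -> arc S (S - t) = arc S t.
Proof.
case/andP=> t_ge0 t_le; rewrite /arc !ger0_norm ?subr_ge0 // minC.
by congr (Num.min _ _); lra.
Qed.

End Arcs.

(** * Distances along the cycle of indecomposable pairs *)

Section CyclicMetric.
Variables (R : realType) (T : finType) (D : {set T} -> R).
Hypothesis D_gt0 : forall I : {set T}, #|I| = 2%N -> 0 < D I.
Hypothesis D_triangle : forall i j k : T, i != j -> i != k -> j != k ->
  entry D i j <= entry D i k + entry D k j.
Hypothesis deg2 : forall x, #|[set y | link D x y]| = 2%N.
Variables (x0 : T) (s : seq T).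
Hypotheses (s_uniq : uniq s) (s_cycle : cycle (link D) s).
Hypothesis s_size : (3 <= size s)%N.

Let v (k : 'I_(size s)) : T := nth x0 s k.

Lemma cycle_vertex_inj : injective v.
Proof. by move=> i j /eqP; rewrite nth_uniq // => /eqP/val_inj. Qed.

Lemma cycle_vertex_link (k : 'I_(size s)) : link D (v k) (v (ordS k)).
Proof. exact: cycle_nth. Qed.

(** Connectedness comes from [link_walk]; it rules out a union of several cycles. *)
Lemma cycle_vertex_onto (x : T) : exists k, x = v k.
Proof.
have k0 : 'I_(size s) by case: (size s) s_size => // m _; exact: ord0.
apply: (cycle_onto (e := link D) (link_sym D) deg2 k0) => //.
- exact: cycle_vertex_inj.
- exact: cycle_vertex_link.
move=> a b ab; have [p [ap p_last _]] := link_walk D_gt0 D_triangle ab.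
by exists p => //; rewrite -(eq_path (adj_link_graph D_gt0)).
Qed.

Lemma cycle_size : size s = #|T|.
Proof.
rewrite -(card_uniqP s_uniq); apply: eq_card => x; rewrite inE.
by have [k ->] := cycle_vertex_onto x; rewrite mem_nth.
Qed.

(** Names start from 1, positions in [s] from 0; this matches [named]. *)
Let g (k : nat) : T := nth x0 s k.-1.
Let W (i : nat) : R := entry D (g i) (g i.+1).

(* The length of the shortest arc from [g a] is a 1-Lipschitz function on the
   cycle, hence a lower bound for the weight of every walk from [g a]. *)
Lemma entry_cycle (a b : nat) : (1 <= a)%N -> (a < b)%N -> (b <= size s)%N ->
  entry D (g a) (g b) =
  Num.min (\sum_(a <= i < b) W i)
          (\sum_(b <= i < size s) W i + entry D (g 1%N) (g (size s))
           + \sum_(1 <= i < a) W i).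
Proof.
set n := size s => a_ge1 ab b_le.
have g_neq i j : (1 <= i)%N -> (i < j)%N -> (j <= n)%N -> g i != g j.
  by move=> i_ge1 ij j_le; rewrite nth_uniq // -/n; lia.
have entryE i j : (1 <= i)%N -> (i < j)%N -> (j <= n)%N ->
    entry D (g i) (g j) = dist0 D (g i) (g j).
  by move=> i_ge1 ij j_le; rewrite /dist0 (negPf (g_neq _ _ _ _ _)).
(* [P k] is the position of [g k] on the circle, and [c] the length of the closing edge. *)
set P := fun k => \sum_(1 <= i < k) W i; set c := entry D (g 1%N) (g n).
have sumW i j : (1 <= i)%N -> (i <= j)%N -> \sum_(i <= k < j) W k = P j - P i.
  by move=> i_ge1 ij; rewrite /P (big_cat_nat i_ge1 ij) /= addrAC subrr add0r.
have dist_le i j : (1 <= i)%N -> (i <= j)%N -> (j <= n)%N ->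
    dist0 D (g i) (g j) <= P j - P i.
  move=> i_ge1 ij j_le; rewrite -sumW //.
  rewrite (le_trans (dist0_le_sum D_gt0 D_triangle g ij)) //.
  apply: ler_sum_nat => k /andP[ik kj].
  by rewrite /W entryE //; lia.
have P_mono i j : (1 <= i)%N -> (i <= j)%N -> (j <= n)%N -> P i <= P j.
  move=> i_ge1 ij j_le; rewrite -subr_ge0 (le_trans _ (dist_le _ _ _ _ _)) //.
  exact: dist0_ge0.
have P1 : P 1%N = 0 by rewrite /P big_geq.
have cE : c = dist0 D (g 1%N) (g n) by rewrite /c entryE //; lia.
have c_ge0 : 0 <= c by rewrite cE dist0_ge0.
rewrite !sumW ?P1 ?subr0 //; try lia.
have := P_mono a b a_ge1 (ltnW ab) b_le.
have := P_mono b n (leq_ltn_trans (leq0n a) ab) b_le (leqnn n).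
have := P_mono 1%N a (leqnn 1) a_ge1 (ltnW (leq_trans ab b_le)).
rewrite P1 => Pa_ge0 Pbn Pab.
set S := P n + c.
have -> : P n - P b + c + P a = S - (P b - P a) by rewrite /S; lra.
(* The upper bound is the triangle inequality along either arc; the lower bound needs the potential
   [f] below. *)
apply/le_anti/andP; split.
  rewrite le_min entryE // dist_le ?(ltnW ab) //=.
  rewrite (le_trans (dist0_triangle D_gt0 D_triangle _ _ (g 1%N))) //.
  have := dist0_triangle D_gt0 D_triangle (g 1%N) (g b) (g n).
  have := dist_le 1%N a (leqnn 1) a_ge1 (ltnW (leq_trans ab b_le)).
  have := dist_le b n (leq_ltn_trans (leq0n a) ab) b_le (leqnn n).
  rewrite -cE P1 (dist0C D (g n)) (dist0C D (g a)) /S; lra.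
pose f y := arc S (P (index y s).+1 - P a).
have f_nth k : (1 <= k)%N -> (k <= n)%N -> f (g k) = arc S (P k - P a).
  by move=> k_ge1 k_le; rewrite /f /g index_uniq ?prednK //; lia.
have step (k : 'I_n) : f (v k) <= f (v (ordS k)) + entry D (v k) (v (ordS k)) /\
    f (v (ordS k)) <= f (v k) + entry D (v k) (v (ordS k)).
  have := ltn_ord k; rewrite -/n leq_eqVlt => /orP[/eqP k_eq|k_lt].
    have -> : v k = g n by rewrite /v /g -k_eq.
    have -> : v (ordS k) = g 1%N by rewrite /v /g /= -/n k_eq modnn.
    rewrite entryC -/c !f_nth // ?P1; try lia.
    (* Across the closing edge, the start at position 0 is viewed at position [S], at displacement
       [c] from [P n]. *)
    have -> : arc S (0 - P a) = arc S (S - P a).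
      by rewrite sub0r arcN arc_compl // /S; lra.
    have dE : S - P a - (P n - P a) = c by rewrite /S; lra.
    have := arc_lipschitz S (S - P a) (P n - P a).
    have := arc_lipschitz S (P n - P a) (S - P a).
    by rewrite (distrC (P n - P a)) dE ger0_norm.
  have -> : v k = g k.+1 by [].
  have -> : v (ordS k) = g k.+2 by rewrite /v /g /= modn_small.
  rewrite -/(W k.+1) !f_nth //; try lia.
  have W_ge0 : 0 <= W k.+1 by rewrite /W entryE // dist0_ge0.
  have dE : P k.+2 - P a - (P k.+1 - P a) = W k.+1.
    by rewrite {1}/P big_nat_recr //= -/(P _); lra.
  have := arc_lipschitz S (P k.+2 - P a) (P k.+1 - P a).
  have := arc_lipschitz S (P k.+1 - P a) (P k.+2 - P a).
  by rewrite (distrC (P k.+1 - P a)) dE ger0_norm.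
have f_lip x y : link D x y -> f y <= f x + entry D x y.
  have [k ->] := cycle_vertex_onto x.
  rewrite (cycle_nbr (link_sym D) deg2 s_size cycle_vertex_inj cycle_vertex_link).
  case/orP=> /eqP->; first by have [] := step k.
  by have [] := step (ord_pred k); rewrite ord_predK entryC.
have f_walk p x : path (link D) x p ->
    f (last x p) <= f x + path_weight (link_graph D_gt0) x p.
  elim: p x => [|y p IH] x /=; first by rewrite /path_weight big_nil addr0.
  case/andP=> /f_lip le_y /IH le_p; rewrite path_weight_link_cons; lra.
(* Along a walk of weight [entry D (g a) (g b)], [f] grows from 0 to the shortest arc length. *)
have [p [ap p_last p_w]] := link_walk D_gt0 D_triangle (g_neq a b a_ge1 ab b_le).
rewrite (eq_path (adj_link_graph D_gt0)) in ap.
have := f_walk p (g a) ap; rewrite p_last p_w !f_nth //; try lia.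
rewrite subrr {2}/arc normr0 subr0 min_l ?add0r; last by rewrite /S; lra.
by rewrite /arc ger0_norm // subr_ge0.
Qed.

Lemma link_graph_polygon : polygon (size s) (link_graph D_gt0).
Proof.
split=> //; exists v.
  apply: inj_card_bij; first exact: cycle_vertex_inj.
  by rewrite card_ord cycle_size.
apply/setP => e; apply/imsetP/imsetP => [[[a b]]|[k _ ->]]; last first.
  by exists (v k, v (ordS k)); rewrite ?inE ?cycle_vertex_link.
rewrite inE /= => + ->; have [k ->] := cycle_vertex_onto a.
rewrite (cycle_nbr (link_sym D) deg2 s_size cycle_vertex_inj cycle_vertex_link).
case/orP=> /eqP->; first by exists k.
by exists (ord_pred k); rewrite // ord_predK setUC.
Qed.

End CyclicMetric.

(** * Degrees in a polygon, and the equivalence *)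

Lemma polygon_deg2 (R : realType) (T : finType) (n : nat) (G : wgraph R T) (x : T) :
  polygon n G -> #|[set y | adj G x y]| = 2%N.
Proof.
case=> n3 [v /[dup] /bij_inj v_inj [u vK uK] edgesE].
rewrite -[x]uK; set k := u x.
suff -> : [set y | adj G (v k) y] = [set v (ordS k); v (ord_pred k)].
  by rewrite cards2 (inj_eq v_inj) ordS_neq_pred.
apply/setP => y; rewrite !inE /adj edgesE; apply/imsetP/orP.
  case=> j _ /set2_inj[[/v_inj-> ->]|[/v_inj-> ->]]; first by left.
  by right; rewrite ordSK.
case=> /eqP->; first by exists k.
by exists (ord_pred k); rewrite // ord_predK setUC.
Qed.

Theorem theorem4p3 (R : realType) (n : nat) (D : {set 'I_n} -> R)
  (D_gt0 : forall I : {set 'I_n}, #|I| = 2%N -> 0 < D I)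
  (D_triangle : forall i j k : 'I_n, i != j -> i != k -> j != k ->
     entry D i j <= entry D i k + entry D k j)
  (x1 x2 : 'I_n) (x1x2_neq : x1 != x2)
  (x1x2_min : forall i j : 'I_n, i != j -> entry D x1 x2 <= entry D i j) :
  (exists P : wgraph R 'I_n,
     [/\ polygon n P, pruned P &
         forall i j : 'I_n, i != j -> is_dist P i j (entry D i j)])
  <->
  [/\ forall i : 'I_n, #|[set x | (x != i) && indecomposable D i x]| = 2%N,
      #|[set x in rename D x1 x2]| = n &
      let D' (a b : nat) : R := entry D (named D x1 x2 a) (named D x1 x2 b) in
      forall a b : nat, (1 <= a)%N -> (a < b)%N -> (b <= n)%N ->
        D' a b =
        Num.min (\sum_(a <= i < b) D' i i.+1)
                (\sum_(b <= i < n) D' i i.+1 + D' 1%N n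
                 + \sum_(1 <= i < a) D' i i.+1)].
Proof.
(* A pair of minimal value is indecomposable: the first leg of any detour is at least as long, and
   the second is positive. *)
have x12 : link D x1 x2.
  apply/linkP; split=> [|z z1 z2]; first by rewrite eq_sym.
  apply: (le_lt_trans (x1x2_min x1 z _)); first by rewrite eq_sym.
  by rewrite ltrDl entry_gt0.
split=> [[P [P_poly P_pruned P_dist]]|[deg2 _ _]].
  have deg2 i : #|[set x | link D i x]| = 2%N.
    rewrite -(polygon_deg2 i P_poly); apply: eq_card => x; rewrite !inE.
    by apply/idP/idP; [apply: link_adj | apply: pruned_adj_link].
  have [q [q_eq q_size q_uniq q_cycle]] := rename_cycle deg2 x12.
  have size_n : size (x1 :: q) = n.
    by rewrite (cycle_size D_gt0 D_triangle deg2) // card_ord.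
  split=> //; first by rewrite q_eq cardsE (card_uniqP q_uniq).
  move=> D' a b a_ge1 ab b_le.
  have := entry_cycle D_gt0 D_triangle deg2 x1 q_uniq q_cycle q_size a_ge1 ab.
  by rewrite size_n /D' /named q_eq => ->.
have {}deg2 i : #|[set x | link D i x]| = 2%N := deg2 i.
have [q [q_eq q_size q_uniq q_cycle]] := rename_cycle deg2 x12.
have size_n : size (x1 :: q) = n.
  by rewrite (cycle_size D_gt0 D_triangle deg2) // card_ord.
exists (link_graph D_gt0); split.
- have := link_graph_polygon D_gt0 D_triangle deg2 x1 q_uniq q_cycle q_size.
  by rewrite size_n.
- exact: link_graph_pruned.
- exact: link_graph_dist.
Qed.
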